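(* Let $F(X,Z)$ be a real binary form with no real roots, of degree $2n$ with $n\ge 1$, and let $\alpha_1,\ldots,\alpha_n\in\mathbb H^2$ be its upper-half-plane roots (listed with multiplicity). Let $P\in\mathbb H^2$, let $t_i=d_H(P,\alpha_i)$, and let $\mathbf{v}_i\in T_P\mathbb H^2$ be the unit tangent vector at $P$ pointing toward $\alpha_i$. Then $$P=\xi_{\mathcal J}(F)\quad\Longleftrightarrow\quad \sum_{i=1}^n \tanh(t_i)\,\mathbf{v}_i=0 .$$
   Context: $\mathbb H^2=\{x+iy: y>0\}$ is the upper half-plane with hyperbolic distance $d_H$, $\cosh d_H(x+iy,u+iv)=1+\frac{(x-u)^2+(y-v)^2}{2yv}$. ''Pointing toward $\alpha_i$'' means tangent at $P$ to the geodesic from $P$ to $\alpha_i$; if $\alpha_i=P$, then $t_i=0$ and the corresponding term is $0$. A real binary form of degree $2n$ with no real roots (in $\mathbb P^1(\mathbb R)$) factors as $F(X,Z)=a_0\prod_{i=1}^n (X-\alpha_iZ)(X-\overline{\alpha_i}Z)$ with $a_0\in\mathbb R\setminus\{0\}$ and $\alpha_i\in\mathbb H^2$. Hyperbolic 3-space is $\mathbb H^3=\{z+t\mathbf{j}: z\in\mathbb C,\ t>0\}$ (upper half-space model), and $\mathbb H^2$ is embedded in $\mathbb H^3$ by $x+iy\mapsto x+y\mathbf{j}$. For $w=z+t\mathbf{j}\in\mathbb H^3$ and $\alpha\in\mathbb C$ (the boundary floor) put $d_H(w,\alpha)=\ln\frac{|z-\alpha|^2+t^2}{t}$. A binary form of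 degree $N$ is stable if none of its roots has multiplicity at least $N/2$. For a stable form $F$ of degree $N$ with roots $\beta_1,\ldots,\beta_N\in\mathbb C$ (with multiplicity), Julia's zero $\xi_{\mathcal J}(F)$ is the unique point $w\in\mathbb H^3$ minimizing $\sum_{i=1}^N d_H(w,\beta_i)$. For a real form with no real roots, $\xi_{\mathcal J}(F)$ lies in $\mathbb H^2\subset\mathbb H^3$. If a real form with no real roots is not stable, then all its upper-half-plane roots coincide, $\alpha_1=\cdots=\alpha_n=\alpha$, and by convention $\xi_{\mathcal J}(F)=\alpha$. *)

(* Defs.v *)
From HB Require Import structures.
From mathcomp Require Import all_boot all_order all_algebra.
From mathcomp Require Import all_classical all_reals all_analysis.
From mathcomp Require Import complex.
(* The notations of mpoly are incompatible with those of analysis. *)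
From mathcomp Require Import -(notations) mpoly.

Set Implicit Arguments.
Unset Strict Implicit.
Unset Printing Implicit Defensive.

Import Order.TTheory GRing.Theory Num.Theory.
Import numFieldNormedType.Exports.

Local Open Scope ring_scope.
Local Open Scope classical_set_scope.
Local Open Scope complex_scope.

Local Notation Re := complex.Re.
Local Notation Im := complex.Im.

Section HyperbolicFunctions.
Context {R : realType}.
Implicit Types t x : R.

Definition cosh t : R := (expR t + expR (- t)) / 2.
Definition sinh t : R := (expR t - expR (- t)) / 2.
Definition tanh t : R := sinh t / cosh t.
Definition arcosh x : R := ln (x + Num.sqrt (x ^+ 2 - 1)).

Lemma arcosh_ge0 x : 1 <= x -> 0 <= arcosh x.
Proof.
by move=> x1; rewrite ln_ge0// (le_trans x1)// lerDl sqrtr_ge0.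
Qed.

Lemma arcoshK x : 1 <= x -> cosh (arcosh x) = x.
Proof.
move=> x1; have x0 : 0 < x by rewrite (lt_le_trans _ x1).
have h : 0 <= x ^+ 2 - 1 by rewrite subr_ge0 exprn_ege1.
set s := Num.sqrt (x ^+ 2 - 1).
have s2 : s ^+ 2 = x ^+ 2 - 1 by rewrite sqr_sqrtr.
have p : 0 < x + s by rewrite ltr_wpDr// sqrtr_ge0.
have e : (x + s)^-1 = x - s.
  apply: (mulfI (lt0r_neq0 p)); rewrite divff ?lt0r_neq0//.
  by rewrite [RHS]mulrC -subr_sqr s2 opprB addrC subrK.
rewrite /cosh /arcosh -/s expRN lnK ?posrE// e.
by rewrite addrACA subrr addr0 -mulr2n -[x *+ 2]mulr_natr mulfK// pnatr_eq0.
Qed.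

End HyperbolicFunctions.

Section HyperbolicSpaces.
Variable R : realType.

Definition H2 := {z : R[i] | 0 < Im z}.

(* The pair [(z, t)] stands for the point [z + t j]. *)
Definition H3 := {w : R[i] * R | 0 < w.2}.

(* The point [x + y j] for [x + i y] in [H2]. *)
Definition H2_to_H3 (P : H2) : H3 :=
  exist (fun w : R[i] * R => is_true (0 < w.2))
    ((Re (val P))%:C, Im (val P)) (valP P).

Definition H3_j : H3 :=
  exist (fun w : R[i] * R => is_true (0 < w.2)) (0, 1) ltr01.

Definition cosh_dist (P Q : H2) : R :=
  1 + ((Re (val P) - Re (val Q)) ^+ 2 + (Im (val P) - Im (val Q)) ^+ 2)
      / (2 * Im (val P) * Im (val Q)).

Definition dist_H2 (P Q : H2) : R := arcosh (cosh_dist P Q).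

Lemma cosh_dist_ge1 P Q : 1 <= cosh_dist P Q.
Proof.
case: P Q => [p hp] [q hq]; rewrite /cosh_dist /= lerDl divr_ge0//.
- by rewrite addr_ge0 ?sqr_ge0.
- by rewrite !mulr_ge0// ltW.
Qed.

Lemma dist_H2_ge0 P Q : 0 <= dist_H2 P Q.
Proof. exact/arcosh_ge0/cosh_dist_ge1. Qed.

Lemma cosh_dist_H2 P Q : cosh (dist_H2 P Q) = cosh_dist P Q.
Proof. exact/arcoshK/cosh_dist_ge1. Qed.

(* A complete geodesic parametrised by arc length, i.e. an isometric embedding
   of the real line. *)
Definition unit_speed_geodesic (gamma : R -> H2) : Prop :=
  forall s t : R, dist_H2 (gamma s) (gamma t) = `|s - t|.

(* Tangent vectors at [P] are written in the chart [H2] of the complex plane, so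
   [T_P H2] is [R[i]] with the metric (dx^2 + dy^2) / y^2. *)
Definition tangent_norm (P : H2) (v : R[i]) : R := ComplexField.Normc.normc v / Im (val P).

Definition velocity (gamma : R -> H2) (s : R) (v : R[i]) : Prop :=
  is_derive s (1 : R) (fun t => Re (val (gamma t))) (Re v) /\
  is_derive s (1 : R) (fun t => Im (val (gamma t))) (Im v).

(* Meant for [alpha] distinct from [P]: if [alpha = P], every unit vector at
   [P] satisfies it. *)
Definition unit_tangent_toward (P alpha : H2) (v : R[i]) : Prop :=
  tangent_norm P v = 1 /\
  exists gamma : R -> H2,
    [/\ unit_speed_geodesic gamma, gamma 0 = P,
        gamma (dist_H2 P alpha) = alpha & velocity gamma 0 v].

(* The "distance" from a point of [H3] to a point of the boundary floor. *)
Definition dist_H3_floor (w : H3) (beta : R[i]) : R :=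
  ln ((ComplexField.Normc.normc ((val w).1 - beta) ^+ 2 + (val w).2 ^+ 2) / (val w).2).

End HyperbolicSpaces.

(* A binary form of degree [N] is an element of [bpoly K] that is homogeneous of
   degree [N]. *)
Definition bpoly (K : comNzRingType) := mpoly 2 K.

Section BinaryForms.
Variable K : comNzRingType.

Definition is_form (N : nat) (F : bpoly K) : Prop :=
  F \is ishomog1 N mdeg.

Definition varX : bpoly K := mpolyX K (mnm1 (0 : 'I_2)).
Definition varZ : bpoly K := mpolyX K (mnm1 (1 : 'I_2)).

Definition eval_form (F : bpoly K) (x z : K) : K :=
  meval (fun i : 'I_2 => if i == 0 then x else z) F.

(* [X - beta Z] *)
Definition lin_form (beta : K) : bpoly K := varX - beta *: varZ.

(* [s] lists, with multiplicity, the roots of [F], none of them at infinity. *)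
Definition is_root_list (F : bpoly K) (s : seq K) : Prop :=
  exists2 c : K, c != 0 & F = c *: \prod_(beta <- s) lin_form beta.

Definition form_roots (F : bpoly K) : seq K :=
  xget [::] [set s | is_root_list F s].

(* Stability of a form of degree [N] without root at infinity. *)
Definition stable (N : nat) (F : bpoly K) : bool :=
  all (fun beta => (2 * count_mem beta (form_roots F) < N)%N) (form_roots F).

End BinaryForms.

Section RealForms.
Variable R : realType.

Definition complexify (F : bpoly R) : bpoly R[i] :=
  map_mpoly (real_complex R) F.

(* Absence of roots in the real projective line. *)
Definition no_real_roots (F : bpoly R) : Prop :=
  forall x z : R, (x, z) != (0, 0) -> eval_form F x z != 0.

Definition upper_roots (n : nat) (F : bpoly R) (alpha : 'I_n -> H2 R) : Prop :=
  exists2 a0 : R, a0 != 0 &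
    complexify F = a0%:C *:
      \prod_(i < n) (lin_form (val (alpha i) : R[i]) * lin_form (conjc (val (alpha i)) : R[i])).

Definition julia_sum (s : seq R[i]) (w : H3 R) : R :=
  \sum_(beta <- s) dist_H3_floor w beta.

(* The unique minimiser of the sum; the default value [j] is immaterial. *)
Definition julia_zero_stable (F : bpoly R[i]) : H3 R :=
  xget (H3_j R) [set w | forall w' : H3 R, w' != w ->
    julia_sum (form_roots F) w < julia_sum (form_roots F) w'].

(* The common value of the roots in the upper half plane. *)
Definition julia_zero_unstable (F : bpoly R[i]) : H3 R :=
  xget (H3_j R) [set w | exists2 alpha : H2 R,
    (forall z : H2 R, (val z \in form_roots F) = (z == alpha)) &
    w = H2_to_H3 alpha].

(* For real forms [F] of degree [N] without real roots. *)
Definition julia_zero (N : nat) (F : bpoly R) : H3 R :=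
  if stable N (complexify F) then julia_zero_stable (complexify F)
  else julia_zero_unstable (complexify F).

End RealForms.

(* Main.v *)
Require Import Defs.
From HB Require Import structures.
From mathcomp Require Import all_boot all_order all_algebra.
From mathcomp Require Import all_classical all_reals all_analysis.
From mathcomp Require Import complex.
From mathcomp Require Import -(notations) mpoly.
From mathcomp Require Import ring lra.

Set Implicit Arguments.
Unset Strict Implicit.
Unset Printing Implicit Defensive.

Import Order.TTheory GRing.Theory Num.Theory.
Import numFieldNormedType.Exports.

Local Open Scope ring_scope.
Local Open Scope complex_scope.

Local Notation Re := complex.Re.
Local Notation Im := complex.Im.

(** Julia's zero minimises a sum of Busemann functions on hyperbolic 3-space.
    The gradient of such a function at a point is minus the unit vector towards
    its floor point, and each Busemann function is convex along geodesics;
    hence a point is the minimiser exactly when the unit vectors towards all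
    the roots add up to zero there. The theorem says how this equation reads
    inside the hyperbolic plane.

    Let [P] be a point of the plane and [u beta] the unit vector at [P] towards
    the floor point [beta], with coordinates [dir1], [dir2] along the floor and
    [dir3] upwards. Conjugate roots have directions that are mirror images in
    the plane, so [u alpha] and its conjugate have a sum tangent to the plane.
    The geodesic between the two floor points meets the plane orthogonally at
    the point [alpha] of the plane. By the angle of parallelism, half of that
    sum is then [tanh t] times the unit vector towards this point, where [t] is
    its distance to [P] ([tanh_unit_tangent]). So the vector equation of the
    theorem says that the [u beta], over all the roots, cancel ([balanced]).

    A balanced point is the strict minimiser as soon as the roots in the upper
    half plane are not all equal to it ([balanced_strict_min]): with [s] the
    distance to another point [w] and [k] the cosine of the angle at [P] between
    the directions of [w] and of [beta], passing from [P] to [w] adds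
    [ln (cosh s - k * sinh s)] to the Busemann function of [beta]. This is at
    least the linear term [- k * s], and the linear terms cancel in the sum. The
    inequality is an equality only when [beta] is an end of the geodesic through
    [P] and [w], which holds for both members of a conjugate pair only when
    their point of the plane is [P].

    Conversely Julia's zero is balanced because some balanced point exists
    ([balanced_exists]): the sum of the Busemann functions restricted to the
    plane has compact sublevel sets, and a minimum on the plane is a critical
    point. By strictness that point is Julia's zero.

    A root has multiplicity at least [n] exactly when all the points [alpha i]
    coincide ([stableNE]). In this unstable case the balance condition and
    Julia's convention both single out the common value. *)

(** * The roots of a binary form *)

Section RootLists.
Variable K : fieldType.

Definition dehomogenize (F : bpoly K) : {poly K} :=
  mmap (polyC : K -> {poly K}) (fun i : 'I_2 => if i == 0 then 'X else 1) F.

Lemma dehomogenize_lin_form (beta : K) :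
  dehomogenize (lin_form beta) = 'X - beta%:P.
Proof.
rewrite /dehomogenize /lin_form /varX /varZ mmapB mmapZ !mmapX !mmap1U /=.
by rewrite mulr1.
Qed.

Lemma dehomogenize_prod (c : K) (s : seq K) :
  dehomogenize (c *: \prod_(beta <- s) lin_form beta) =
  c *: \prod_(beta <- s) ('X - beta%:P).
Proof.
rewrite /dehomogenize mmapZ mul_polyC rmorph_prod; congr (_ *: _).
by apply: eq_bigr => beta _; exact: dehomogenize_lin_form.
Qed.

(** Without roots at infinity, setting [Z = 1] loses nothing, so unique
    factorization of univariate polynomials applies. *)
Lemma is_root_list_perm_eq (F : bpoly K) (s t : seq K) :
  is_root_list F s -> is_root_list F t -> perm_eq s t.
Proof.
move=> [c c0 Fs] [d d0 Ft]; apply: prod_XsubC_eq.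
have := dehomogenize_prod c s; rewrite -Fs Ft dehomogenize_prod => e.
have cd : d = c.
  by have /(congr1 lead_coef) := e; rewrite !lead_coefZ
    !(monicP (monic_prod_XsubC _ _ _)) !mulr1.
by move: e; rewrite cd => /(scalerI c0) ->.
Qed.

Lemma form_roots_perm_eq (F : bpoly K) (s : seq K) :
  is_root_list F s -> perm_eq (form_roots F) s.
Proof.
move=> Fs; apply: (@is_root_list_perm_eq F) => //.
by rewrite /form_roots; apply: xgetPex; exists s.
Qed.

End RootLists.

(** * Directions towards the floor *)

Section HyperbolicFunctionsTheory.
Variable R : realType.
Implicit Type t : R.

Lemma cosh_gt0 t : 0 < cosh t.
Proof. by rewrite divr_gt0// addr_gt0 ?expR_gt0. Qed.

Lemma cosh2_sinh2 t : cosh t ^+ 2 - sinh t ^+ 2 = 1.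
Proof.
have := expR_gt0 t => /lt0r_neq0 h.
by rewrite /cosh /sinh expRN; field.
Qed.

Lemma is_derive_cosh t : is_derive t 1 cosh (sinh t).
Proof.
rewrite /cosh /sinh; apply: is_derive_eq.
by rewrite /GRing.scale/=; ring.
Qed.

Lemma coshN t : cosh (- t) = cosh t.
Proof. by rewrite /cosh opprK addrC. Qed.

Lemma cosh_norm t : cosh `|t| = cosh t.
Proof. by case: ger0P => _; rewrite ?coshN. Qed.

Lemma sinh_gt0 t : 0 <= t -> 1 < cosh t -> 0 < sinh t.
Proof.
move=> t0 ct; have : 0 <= sinh t.
  by rewrite divr_ge0// subr_ge0 ler_expR (le_trans _ t0)// oppr_le0.
rewrite le0r => /orP[/eqP s0|//].
have := cosh2_sinh2 t; rewrite s0 expr0n/= subr0 => /eqP.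
by rewrite gt_eqF// exprn_egt1.
Qed.

End HyperbolicFunctionsTheory.

Section Directions.
Variable R : realType.
Implicit Types (P alpha : H2 R) (beta v : R[i]).

(** The Euclidean distance, squared, in the upper half-space model: divided by
    the height of [P] it is the exponential of the Busemann function. *)
Definition floor_sqdist P beta : R :=
  (Re beta - Re (val P)) ^+ 2 + Im beta ^+ 2 + Im (val P) ^+ 2.

(** [dir1], [dir2] and [dir3] are the coordinates of the hyperbolic unit vector
    at [P] that points to [beta], in the orthonormal frame along the real axis,
    the imaginary axis and the vertical. *)
Definition dir1 P beta : R :=
  2 * Im (val P) * (Re beta - Re (val P)) / floor_sqdist P beta.
Definition dir2 P beta : R := 2 * Im (val P) * Im beta / floor_sqdist P beta.
Definition dir3 P beta : R :=
  (floor_sqdist P beta - 2 * Im (val P) ^+ 2) / floor_sqdist P beta.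

Lemma floor_sqdist_gt0 P beta : 0 < floor_sqdist P beta.
Proof. by rewrite ltr_wpDl ?addr_ge0 ?sqr_ge0 ?exprn_gt0 ?(valP P). Qed.

Lemma dir_unit P beta :
  dir1 P beta ^+ 2 + dir2 P beta ^+ 2 + dir3 P beta ^+ 2 = 1.
Proof.
have := floor_sqdist_gt0 P beta; rewrite /dir1 /dir2 /dir3 => /lt0r_neq0.
by rewrite /floor_sqdist => D0; field.
Qed.

Lemma floor_sqdist_conj P beta :
  floor_sqdist P (conjc beta) = floor_sqdist P beta.
Proof. by case: beta => a b; rewrite /floor_sqdist /= sqrrN. Qed.

Lemma dir1_conj P beta : dir1 P (conjc beta) = dir1 P beta.
Proof. by rewrite /dir1 floor_sqdist_conj; case: beta. Qed.

Lemma dir2_conj P beta : dir2 P (conjc beta) = - dir2 P beta.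
Proof.
by rewrite /dir2 floor_sqdist_conj; case: beta => a b /=; rewrite mulrN mulNr.
Qed.

Lemma dir3_conj P beta : dir3 P (conjc beta) = dir3 P beta.
Proof. by rewrite /dir3 floor_sqdist_conj. Qed.

Lemma eq_H2 P alpha :
  Re (val P) = Re (val alpha) -> Im (val P) = Im (val alpha) -> P = alpha.
Proof.
move=> eRe eIm; apply: val_inj.
by move: eRe eIm; case: (val P) => a b; case: (val alpha) => c d /= -> ->.
Qed.

Lemma H2_to_H3_inj : injective (@H2_to_H3 R).
Proof. by move=> P Q /(congr1 val) /= [eRe eIm]; exact: eq_H2. Qed.

(** The direction of [alpha] is orthogonal to the plane only at the point where
    the geodesic from [alpha] to its conjugate crosses the plane. *)
Lemma dir_eq0 P alpha :
  dir1 P (val alpha) = 0 /\ dir3 P (val alpha) = 0 <-> alpha = P.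
Proof.
have y0 := valP P; have b0 := valP alpha.
have Dn0 := lt0r_neq0 (floor_sqdist_gt0 P (val alpha)).
split=> [[/eqP d1 /eqP d3]|->]; last first.
  rewrite /dir1 /dir3 subrr mulr0 mul0r; split=> //.
  by rewrite (_ : _ - _ = 0) ?mul0r// /floor_sqdist; ring.
move: d1; rewrite !mulf_eq0 invr_eq0 (negbTE Dn0) orbF pnatr_eq0 (gt_eqF y0)/=.
move=> /eqP ab; move: d3; rewrite mulf_eq0 invr_eq0 (negbTE Dn0) orbF.
rewrite /floor_sqdist ab expr0n/= add0r => /eqP e.
apply: eq_H2; first by apply/eqP; rewrite -subr_eq0 ab.
by apply/eqP; rewrite -(@eqrXn2 _ 2) ?ltW//; apply/eqP; lra.
Qed.

Lemma cosh_distE P alpha :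
  cosh_dist P alpha =
  floor_sqdist P (val alpha) / (2 * Im (val P) * Im (val alpha)).
Proof.
have y0 := lt0r_neq0 (valP P); have b0 := lt0r_neq0 (valP alpha).
by rewrite /cosh_dist /floor_sqdist; field; rewrite b0 y0.
Qed.

Lemma cosh_dist_gt1 P alpha : alpha <> P -> 1 < cosh_dist P alpha.
Proof.
move=> neq; rewrite lt_neqAle cosh_dist_ge1 andbT; apply/eqP => e1.
apply: neq; have y0 := valP P; have b0 := valP alpha.
move: e1; rewrite /cosh_dist => /eqP.
rewrite eq_sym -subr_eq0 addrAC subrr add0r.
rewrite mulf_eq0 invr_eq0 !mulf_eq0 pnatr_eq0 (gt_eqF y0) (gt_eqF b0)/= orbF.
rewrite paddr_eq0 ?sqr_ge0// !sqrf_eq0 !subr_eq0 => /andP[/eqP e1 /eqP e2].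
exact: eq_H2.
Qed.

(** A geodesic need not be computed. Along a unit speed geodesic from [P] that
    reaches [alpha] at time [t], the hyperbolic cosine of the distance to
    [alpha] is [cosh (s - t)], whose derivative at [0] is [- sinh t]. By the
    chain rule the hyperbolic inner product of [v] with the vector of
    coordinates [dir1] and [dir3] is then [tanh t]. As [v] is a unit vector and
    the other one has length [tanh t], the Cauchy-Schwarz inequality is an
    equality, which determines [v]. *)
Lemma tanh_unit_tangent P alpha v :
  (alpha <> P -> unit_tangent_toward P alpha v) ->
  (tanh (dist_H2 P alpha))%:C * v =
  (Im (val P) * dir1 P (val alpha) +i* (Im (val P) * dir3 P (val alpha)))%C.
Proof.
have yn0 := lt0r_neq0 (valP P); have bn0 := lt0r_neq0 (valP alpha).
have Dn0 := lt0r_neq0 (floor_sqdist_gt0 P (val alpha)).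
have [-> _|/eqP neq] := eqVneq alpha P.
  have -> : tanh (dist_H2 P P) = 0.
    rewrite /dist_H2 /cosh_dist !subrr expr0n/= addr0 mul0r addr0.
    rewrite /arcosh expr1n subrr sqrtr0 addr0 ln1.
    by rewrite /tanh /sinh oppr0 subrr !mul0r.
  by have [-> ->] := (dir_eq0 P P).2 erefl; rewrite mul0r mulr0.
move=> /(_ neq) [norm1 [gamma [geo g0 g1 [dRe dIm]]]].
set t := dist_H2 P alpha.
have ct : cosh t = cosh_dist P alpha by exact: cosh_dist_H2.
have st : 0 < sinh t.
  by apply: sinh_gt0; rewrite ?dist_H2_ge0// ct; exact: cosh_dist_gt1.
pose gx s := Re (val (gamma s)); pose gy s := Im (val (gamma s)).
pose x := Re (val P); pose y := Im (val P).
pose a := Re (val alpha); pose b := Im (val alpha).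
have coshE s : cosh (s - t) =
    ((gx s - a) ^+ 2 + gy s ^+ 2 + b ^+ 2) * (gy s)^-1 * (2 * b)^-1.
  rewrite -cosh_norm -geo g1 cosh_dist_H2 cosh_distE /floor_sqdist.
  rewrite /gx /gy /a /b; have := lt0r_neq0 (valP (gamma s)) => ?.
  by field; apply/andP.
have dl : is_derive (0 : R) 1 (fun s => cosh (s - t)) (- sinh t).
  have dsh : is_derive (0 : R) 1 (fun s => s - t) 1.
    by apply: is_derive_eq; rewrite subr0.
  have dcosh := is_derive_cosh (0 - t).
  have dc := @is_derive1_comp R cosh (fun s => s - t) 0 _ _ dcosh dsh.
  apply: (is_derive_eq dc).
  by rewrite /sinh sub0r opprK; field.
have dr : is_derive (0 : R) 1 (fun s => cosh (s - t))
    (Re v * ((x - a) / (y * b)) +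
     Im v * ((y ^+ 2 - (x - a) ^+ 2 - b ^+ 2) / (2 * y ^+ 2 * b))).
  rewrite (_ : (fun s => _) = (fun s => ((gx s - a) ^+ 2 + gy s ^+ 2 + b ^+ 2)
    * (gy s)^-1 * (2 * b)^-1)); last by apply/funext => s; rewrite coshE.
  have gy0 : gy 0 != 0 by exact: lt0r_neq0 (valP (gamma 0)).
  have dx : is_derive (0 : R) 1 gx (Re v) := dRe.
  have dy : is_derive (0 : R) 1 gy (Im v) := dIm.
  have dyV := is_deriveV gy0 dy.
  apply: is_derive_eq.
  have -> : gx 0 = x by rewrite /gx g0.
  have -> : gy 0 = y by rewrite /gy g0.
  rewrite /GRing.scale/=.
  by field; apply/andP.
have slope : Re v * ((x - a) / (y * b)) +
    Im v * ((y ^+ 2 - (x - a) ^+ 2 - b ^+ 2) / (2 * y ^+ 2 * b)) = - sinh t.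
  by rewrite -(@derive_val _ _ _ _ _ _ _ dl) (@derive_val _ _ _ _ _ _ _ dr).
have v2 : Re v ^+ 2 + Im v ^+ 2 = y ^+ 2.
  move: norm1; rewrite /tangent_norm; case: (v) => p q /= /(congr1 ( *%R^~ y)).
  rewrite -/y mul1r mulfVK// => <-.
  by rewrite sqr_sqrtr// addr_ge0 ?sqr_ge0.
have D0 : (a - x) ^+ 2 + b ^+ 2 + y ^+ 2 != 0 by [].
have cE := cosh_distE P alpha; have cn0 := lt0r_neq0 (cosh_gt0 t).
have slopeT :
    Re v * dir1 P (val alpha) + Im v * dir3 P (val alpha) = y * tanh t.
  rewrite /tanh -[sinh t]opprK -slope ct cE /dir1 /dir3 /floor_sqdist.
  by rewrite -/x -/y -/a -/b; field; rewrite D0 bn0 yn0.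
have T2 : tanh t ^+ 2 = dir1 P (val alpha) ^+ 2 + dir3 P (val alpha) ^+ 2.
  have := dir_unit P (val alpha).
  (* The angle of parallelism: the sine of the angle to the plane is
     [1 / cosh t]. *)
  have -> : dir2 P (val alpha) = (cosh t)^-1.
    by rewrite ct cE /dir2 invf_div.
  move=> unit; have s2 : sinh t ^+ 2 = cosh t ^+ 2 - 1.
    by rewrite -(cosh2_sinh2 t); ring.
  transitivity (1 - (cosh t)^-1 ^+ 2); last by rewrite -unit; ring.
  by rewrite /tanh exprMn s2; field.
have sq : (tanh t * Re v - y * dir1 P (val alpha)) ^+ 2 +
  (tanh t * Im v - y * dir3 P (val alpha)) ^+ 2 = 0.
  rewrite (_ : _ + _ = tanh t ^+ 2 * (Re v ^+ 2 + Im v ^+ 2)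
    - 2 * tanh t * y * (Re v * dir1 P (val alpha) + Im v * dir3 P (val alpha))
    + y ^+ 2 * (dir1 P (val alpha) ^+ 2 + dir3 P (val alpha) ^+ 2));
    last by ring.
  by rewrite v2 slopeT -T2; ring.
move/eqP: sq; rewrite paddr_eq0 ?sqr_ge0// !sqrf_eq0 !subr_eq0.
rewrite -/t -/y => /andP[/eqP <- /eqP <-].
by case: (v) => p q /=; simpc.
Qed.

End Directions.

(** * A balanced point is the strict minimiser *)

Section Convexity.
Variable R : realType.
Implicit Types (P alpha : H2 R) (beta : R[i]) (w : H3 R).

(** With [k = m / sinh s], the right-hand side is the average of [expR s] and
    [expR (- s)] with weights [(1 - k) / 2] and [(1 + k) / 2], and the left-hand
    side is the geometric mean with the same weights. *)
Lemma expR_cosh_sub (b : bool) (s m : R) : 0 < s -> 0 < sinh s ->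
  m ^+ 2 < sinh s ^+ 2 ?<= if b ->
  expR (- (s / sinh s * m)) < cosh s - m ?<= if b.
Proof.
move=> s0 sh0 msh; pose k := m / sinh s; have shn0 := lt0r_neq0 sh0.
have mE : m = k * sinh s by rewrite /k mulfVK.
have k2 : k ^+ 2 < 1 ?<= if b.
  rewrite /k exprMn exprVn; case: (b) msh => /=.
    by rewrite ler_pdivrMr ?mul1r ?exprn_gt0.
  by rewrite ltr_pdivrMr ?mul1r ?exprn_gt0.
have -> : s / sinh s * m = k * s by rewrite /k; ring.
have shift c x : expR (- (k * s)) * (c * expR x) = c * expR (x - k * s).
  by rewrite expRD; ring.
have -> : cosh s - m = expR (- (k * s)) *
    ((1 - k) / 2 * expR ((1 + k) * s) +
     (1 + k) / 2 * expR (- ((1 - k) * s))).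
  rewrite mulrDr !shift (_ : (1 + k) * s - k * s = s); last by ring.
  rewrite (_ : - _ - k * s = - s); last by ring.
  by rewrite mE /cosh /sinh; field.
(* The weights make the tangent lines of the two exponentials cancel, so that
   [1 + x <= expR x] suffices. *)
have tangent : 1 = (1 - k) / 2 * (1 + (1 + k) * s) +
    (1 + k) / 2 * (1 + - ((1 - k) * s)).
  by field.
case: b k2 {msh} => /= k2.
  have [k1 k1'] : -1 <= k /\ k <= 1 by split; nra.
  rewrite ler_peMr ?expR_ge0// {1}tangent.
  by apply: lerD; apply: ler_wpM2l; rewrite ?expR_ge1Dx//; lra.
have [k1 k1'] : -1 < k /\ k < 1 by split; nra.
rewrite ltr_pMr ?expR_gt0// {1}tangent.
apply: ltrD; (rewrite ltr_pM2l; last by lra); apply: expR_gt1Dx.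
  by rewrite mulf_neq0 ?(lt0r_neq0 s0)//; apply: lt0r_neq0; lra.
by rewrite oppr_eq0 mulf_neq0 ?(lt0r_neq0 s0)//; apply: lt0r_neq0; lra.
Qed.

Definition base_sqdist P w : R :=
  (Re (val w).1 - Re (val P)) ^+ 2 + Im (val w).1 ^+ 2.

(** The hyperbolic cosine of the distance between [P] and [w] in hyperbolic
    3-space. *)
Definition cosh_dist_H3 P w : R :=
  (base_sqdist P w + (val w).2 ^+ 2 + Im (val P) ^+ 2)
  / (2 * (val w).2 * Im (val P)).

(** The displacement from [P] to [w]: the unit vector at [P] towards [w], in the
    frame used for the directions, scaled by the hyperbolic sine of the
    distance. Together with [cosh_dist_H3] it is the point of the hyperboloid
    model that represents [w] when [P] is taken as origin. *)
Definition disp1 P w : R := (Re (val w).1 - Re (val P)) / (val w).2.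
Definition disp2 P w : R := Im (val w).1 / (val w).2.
Definition disp3 P w : R :=
  (base_sqdist P w + (val w).2 ^+ 2 - Im (val P) ^+ 2)
  / (2 * (val w).2 * Im (val P)).

Definition disp_dot P w beta : R :=
  disp1 P w * dir1 P beta + disp2 P w * dir2 P beta + disp3 P w * dir3 P beta.

Lemma disp_norm P w :
  disp1 P w ^+ 2 + disp2 P w ^+ 2 + disp3 P w ^+ 2 = cosh_dist_H3 P w ^+ 2 - 1.
Proof.
have y0 := lt0r_neq0 (valP P); have t0 := lt0r_neq0 (valP w).
rewrite /disp1 /disp2 /disp3 /cosh_dist_H3 /base_sqdist.
by field; rewrite y0 t0.
Qed.

Lemma cosh_dist_H3_gt1 P w : w != H2_to_H3 P -> 1 < cosh_dist_H3 P w.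
Proof.
move=> neq; have y0 := valP P; have t0 := valP w.
have yt0 : 0 < 2 * (val w).2 * Im (val P) by rewrite !mulr_gt0.
rewrite /cosh_dist_H3 ltr_pdivlMr// mul1r -subr_gt0.
rewrite (_ : _ - _ = base_sqdist P w + ((val w).2 - Im (val P)) ^+ 2);
  last by ring.
rewrite lt0r paddr_eq0 ?addr_ge0 ?sqr_ge0// andbT.
apply: contra neq.
rewrite /base_sqdist paddr_eq0 ?sqr_ge0// !sqrf_eq0 !subr_eq0.
move=> /andP[/andP[/eqP e1 /eqP e2] /eqP e3]; apply/eqP/val_inj => /=.
by case: w e1 e2 e3 {t0 yt0} => -[[p q] t] t0 /= -> -> ->.
Qed.

Lemma dist_H3_floor_H2 P beta :
  dist_H3_floor (H2_to_H3 P) beta = ln (floor_sqdist P beta / Im (val P)).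
Proof.
rewrite /dist_H3_floor; case: beta => p q /=; congr (ln (_ / _)).
rewrite sqr_sqrtr ?addr_ge0 ?sqr_ge0// /floor_sqdist /=.
by ring.
Qed.

(** In the hyperboloid model the exponential of a Busemann function is linear:
    it is the pairing with a light-like vector. *)
Lemma dist_H3_floor_ratio P w beta :
  dist_H3_floor w beta = ln (floor_sqdist P beta / Im (val P) *
     (cosh_dist_H3 P w - disp_dot P w beta)).
Proof.
have y0 := lt0r_neq0 (valP P); have t0 := lt0r_neq0 (valP w).
have D0 := lt0r_neq0 (floor_sqdist_gt0 P beta).
rewrite /dist_H3_floor; congr ln.
have -> : ComplexField.Normc.normc ((val w).1 - beta) ^+ 2 =
    (Re (val w).1 - Re beta) ^+ 2 + (Im (val w).1 - Im beta) ^+ 2.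
  case: ((val w).1) => p q; case: (beta) => c d /=.
  by rewrite sqr_sqrtr ?addr_ge0 ?sqr_ge0.
rewrite /disp_dot /cosh_dist_H3 /disp1 /disp2 /disp3 /dir1 /dir2 /dir3.
rewrite /base_sqdist; move: D0; rewrite /floor_sqdist => D0.
by field; rewrite y0 t0 D0.
Qed.

(** Lagrange's identity: the right-hand side is the squared length of the cross
    product of the displacement and the direction. *)
Lemma disp_dot_defect P w beta :
  cosh_dist_H3 P w ^+ 2 - 1 - disp_dot P w beta ^+ 2 =
  (disp2 P w * dir3 P beta - disp3 P w * dir2 P beta) ^+ 2
  + (disp3 P w * dir1 P beta - disp1 P w * dir3 P beta) ^+ 2
  + (disp1 P w * dir2 P beta - disp2 P w * dir1 P beta) ^+ 2.
Proof.
by rewrite -disp_norm -[X in X - _]mulr1 -(dir_unit P beta) /disp_dot; ring.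
Qed.

Lemma disp_dot_le P w beta : disp_dot P w beta ^+ 2 <= cosh_dist_H3 P w ^+ 2 - 1.
Proof. by rewrite -subr_ge0 disp_dot_defect !addr_ge0 ?sqr_ge0. Qed.

Lemma disp_parallel P w beta :
  cosh_dist_H3 P w ^+ 2 - 1 <= disp_dot P w beta ^+ 2 ->
  disp2 P w * dir3 P beta = disp3 P w * dir2 P beta /\
  disp1 P w * dir2 P beta = disp2 P w * dir1 P beta.
Proof.
move=> ge; have /eqP : cosh_dist_H3 P w ^+ 2 - 1 - disp_dot P w beta ^+ 2 = 0.
  by apply/eqP; rewrite subr_eq0 eq_le ge disp_dot_le.
rewrite disp_dot_defect !paddr_eq0 ?addr_ge0 ?sqr_ge0// !sqrf_eq0 !subr_eq0.
by move=> /andP[/andP[/eqP -> _] /eqP ->].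
Qed.

(** Conjugate directions are mirror images in the plane. They can be parallel to
    the same displacement only if they are opposite, hence orthogonal to the
    plane, and that happens only at [P = alpha]. *)
Lemma disp_dot_lt P w alpha : w != H2_to_H3 P -> alpha <> P ->
  disp_dot P w (val alpha) ^+ 2 < cosh_dist_H3 P w ^+ 2 - 1 \/
  disp_dot P w (conjc (val alpha)) ^+ 2 < cosh_dist_H3 P w ^+ 2 - 1.
Proof.
move=> wP neq; have C1 := cosh_dist_H3_gt1 wP.
have [|/disp_parallel[e1 e2]] := ltP; first by left.
have [|/disp_parallel[]] := ltP; first by right.
rewrite !dir1_conj !dir2_conj !dir3_conj => e3 e4.
have d2 : dir2 P (val alpha) != 0.
  rewrite lt0r_neq0// divr_gt0 ?floor_sqdist_gt0//.
  by rewrite !mulr_gt0 ?(valP P) ?(valP alpha).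
have V1 : disp1 P w = 0 by apply: (mulIf d2); rewrite mul0r; lra.
have V3 : disp3 P w = 0 by apply: (mulIf d2); rewrite mul0r; lra.
have V2 : disp2 P w != 0.
  rewrite -sqrf_eq0 lt0r_neq0//; have := disp_norm P w.
  by rewrite V1 V3 expr0n/= add0r addr0 => ->; rewrite subr_gt0 exprn_egt1.
case: neq; apply/dir_eq0; split; apply: (mulfI V2); rewrite mulr0.
  by rewrite -e2 V1 mul0r.
by rewrite e1 V3 mul0r.
Qed.

(** The Busemann function of [beta] lies above its tangent at [P] along the
    geodesic to [w]. *)
Lemma dist_H3_floor_tangent (b : bool) P w beta (s := arcosh (cosh_dist_H3 P w)) :
  w != H2_to_H3 P ->
  disp_dot P w beta ^+ 2 < cosh_dist_H3 P w ^+ 2 - 1 ?<= if b ->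
  dist_H3_floor (H2_to_H3 P) beta - s / sinh s * disp_dot P w beta
  < dist_H3_floor w beta ?<= if b.
Proof.
move=> /cosh_dist_H3_gt1 C1 dot.
have Cs : cosh s = cosh_dist_H3 P w by apply: arcoshK; exact: ltW.
have s0 : 0 <= s by apply: arcosh_ge0; exact: ltW.
have sh0 : 0 < sinh s by apply: sinh_gt0; rewrite ?Cs.
have {}s0 : 0 < s.
  rewrite lt0r s0 andbT; apply: contraTneq sh0 => ->.
  by rewrite /sinh oppr0 subrr mul0r ltxx.
have sh2 : sinh s ^+ 2 = cosh_dist_H3 P w ^+ 2 - 1.
  by rewrite -Cs -(cosh2_sinh2 s); ring.
rewrite -sh2 in dot; have := expR_cosh_sub s0 sh0 dot; rewrite Cs => ebound.
have c0 : 0 < cosh_dist_H3 P w - disp_dot P w beta.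
  by apply: lt_le_trans (expR_gt0 _) (lteifW ebound).
have D0 : 0 < floor_sqdist P beta / Im (val P).
  by rewrite divr_gt0 ?floor_sqdist_gt0 ?(valP P).
rewrite dist_H3_floor_H2 (dist_H3_floor_ratio P).
rewrite (lnM (x := floor_sqdist P beta / _)) ?posrE//.
rewrite lteifD2l -[X in X < _ ?<= if _]expRK.
by case: (b) ebound => /=; rewrite ?ler_ln ?ltr_ln ?posrE ?expR_gt0.
Qed.

Lemma dist_H3_floor_pair P w alpha (s := arcosh (cosh_dist_H3 P w)) :
  w != H2_to_H3 P ->
  dist_H3_floor (H2_to_H3 P) (val alpha)
    + dist_H3_floor (H2_to_H3 P) (conjc (val alpha))
    - 2 * (s / sinh s) * (disp1 P w * dir1 P (val alpha) +
                          disp3 P w * dir3 P (val alpha))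
  < dist_H3_floor w (val alpha) + dist_H3_floor w (conjc (val alpha))
  ?<= if (alpha == P).
Proof.
move=> wP; have bound b beta := @dist_H3_floor_tangent b P w beta wP.
have -> a1 a2 : a1 + a2 - 2 * (s / sinh s) *
    (disp1 P w * dir1 P (val alpha) + disp3 P w * dir3 P (val alpha)) =
    (a1 - s / sinh s * disp_dot P w (val alpha)) +
    (a2 - s / sinh s * disp_dot P w (conjc (val alpha))).
  by rewrite /disp_dot dir1_conj dir2_conj dir3_conj; ring.
have le1 := bound true _ (disp_dot_le P w (val alpha)).
have le2 := bound true _ (disp_dot_le P w (conjc (val alpha))).
case: (eqVneq alpha P) => [_|/eqP neq]; first exact: lerD le1 le2.
have [/(bound false) lt1|/(bound false) lt2] := disp_dot_lt wP neq.
  exact: ltr_leD lt1 le2.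
exact: ler_ltD le1 lt2.
Qed.

End Convexity.

Section StrictMinimum.
Variables (R : realType) (n : nat) (alpha : 'I_n -> H2 R) (P : H2 R).

(** The unit vectors towards the floor points [alpha i] and their conjugates
    cancel: the coordinate [dir2] always does, by conjugation. *)
Definition balanced : Prop :=
  \sum_(i < n) dir1 P (val (alpha i)) = 0 /\
  \sum_(i < n) dir3 P (val (alpha i)) = 0.

Definition conj_pair_sum (w : H3 R) : R :=
  \sum_(i < n) (dist_H3_floor w (val (alpha i)) +
                dist_H3_floor w (conjc (val (alpha i)))).

Lemma balanced_strict_min : balanced -> (exists i, alpha i <> P) ->
  forall w, w != H2_to_H3 P -> conj_pair_sum (H2_to_H3 P) < conj_pair_sum w.
Proof.
move=> [b1 b3] [i neq] w wP.
have := dist_H3_floor_pair _ wP; set c := 2 * _ => pair.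
suff : conj_pair_sum (H2_to_H3 P) -
    \sum_(i < n) (c * (disp1 P w * dir1 P (val (alpha i)) +
                       disp3 P w * dir3 P (val (alpha i)))) < conj_pair_sum w.
  rewrite -mulr_sumr big_split/= -!mulr_sumr b1 b3.
  by rewrite !mulr0 addr0 mulr0 subr0.
rewrite /conj_pair_sum -sumrB (bigD1 i)//= [X in _ < X](bigD1 i)//=.
apply: ltr_leD.
  by have := pair (alpha i); case: eqP neq.
by apply: ler_sum => j _; exact: lteifW (pair _).
Qed.

End StrictMinimum.

(** * Existence of a balanced point *)

Section Existence.
Variable R : realType.
Implicit Types (alpha : H2 R) (x u : R).
Local Open Scope classical_set_scope.

(** The Busemann function of [alpha] on the plane, at the point of abscissa [x]
    and height [expR u]. This logarithmic height makes it a smooth function on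
    the whole of [R * R]. *)
Definition potential alpha x u : R :=
  ln ((x - Re (val alpha)) ^+ 2 + Im (val alpha) ^+ 2 + expR u ^+ 2) - u.

Let arg alpha x u : R :=
  (x - Re (val alpha)) ^+ 2 + Im (val alpha) ^+ 2 + expR u ^+ 2.

Let arg_gt0 alpha x u : 0 < arg alpha x u.
Proof. by rewrite ltr_wpDl ?addr_ge0 ?sqr_ge0 ?exprn_gt0 ?expR_gt0. Qed.

Lemma potentialE alpha x u : expR (potential alpha x u) = arg alpha x u / expR u.
Proof. by rewrite /potential expRD lnK ?expRN// posrE; exact: arg_gt0. Qed.

Lemma potential_ge alpha x u : ln (2 * Im (val alpha)) <= potential alpha x u.
Proof.
have b0 := valP alpha.
rewrite -ler_expR potentialE lnK ?posrE ?mulr_gt0// ler_pdivlMr ?expR_gt0//.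
rewrite -subr_ge0 /arg (_ : _ - _ = (x - Re (val alpha)) ^+ 2
  + (Im (val alpha) - expR u) ^+ 2); last by ring.
by rewrite addr_ge0 ?sqr_ge0.
Qed.

Lemma potential_sublevel alpha x u K : potential alpha x u <= K ->
  [/\ `|x - Re (val alpha)| <= expR K, u <= K & 2 * ln (Im (val alpha)) - K <= u].
Proof.
have b0 := valP alpha.
rewrite -ler_expR potentialE ler_pdivrMr ?expR_gt0// /arg => le.
have u0 := expR_gt0 u; have K0 := expR_gt0 K; have u2 := sqr_ge0 (expR u).
have a2 := sqr_ge0 (x - Re (val alpha)); have b2 := sqr_ge0 (Im (val alpha)).
have uK : expR u <= expR K by rewrite -(ler_pM2r u0) -expr2; lra.
split.
- have K2 : expR K * expR u <= expR K ^+ 2 by rewrite expr2 ler_pM2l.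
  have d2 : (x - Re (val alpha)) ^+ 2 <= expR K ^+ 2 by lra.
  by rewrite ler_norml; apply/andP; split; nra.
- by rewrite -ler_expR.
rewrite -ler_expR expRD expRN expRM_natl lnK ?posrE// ler_pdivrMr// mulrC.
by lra.
Qed.

Lemma is_derive_potential_x alpha x u :
  is_derive x (1 : R) (fun x : R => potential alpha x u)
    (2 * (x - Re (val alpha)) / arg alpha x u).
Proof.
have D0 := arg_gt0 alpha x u; rewrite /potential.
have dl := is_derive1_ln D0.
have da : is_derive x (1 : R) (fun x : R => arg alpha x u)
    (2 * (x - Re (val alpha))).
  by rewrite /arg; apply: is_derive_eq; rewrite /GRing.scale/=; ring.
have dc := @is_derive1_comp R (@ln R) (fun x : R => arg alpha x u) x _ _ dl da.
apply: (is_derive_eq (is_deriveB dc (is_derive_cst u x 1))).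
by rewrite subr0 mulrC.
Qed.

Lemma is_derive_potential_u alpha x u :
  is_derive u (1 : R) (fun u : R => potential alpha x u)
    (2 * expR u ^+ 2 / arg alpha x u - 1).
Proof.
have D0 := arg_gt0 alpha x u; rewrite /potential.
have dl := is_derive1_ln D0.
have da : is_derive u (1 : R) (fun u : R => arg alpha x u) (2 * expR u ^+ 2).
  by rewrite /arg; apply: is_derive_eq; rewrite /GRing.scale/=; ring.
have dc := @is_derive1_comp R (@ln R) (fun u : R => arg alpha x u) u _ _ dl da.
apply: (is_derive_eq (is_deriveB dc (is_derive_id u 1))).
by rewrite mulrC.
Qed.

Lemma continuous_potential alpha :
  continuous (fun p : R * R => potential alpha p.1 p.2).
Proof.
have c1 : continuous (fun p : R * R => p.1) by move=> p; exact: cvg_fst.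
have c2 : continuous (fun p : R * R => p.2) by move=> p; exact: cvg_snd.
move=> p.
apply: (@cvgB _ _ _ _ _ (fun p : R * R => ln (arg alpha p.1 p.2)));
  last exact: c2.
apply: (@continuous_comp _ _ _ (fun p : R * R => arg alpha p.1 p.2) (@ln R));
  last by apply: continuous_ln; exact: arg_gt0.
have cx : (fun p : R * R => p.1 - Re (val alpha)) @ p --> p.1 - Re (val alpha).
  by apply: cvgB; [exact: c1|exact: cvg_cst].
have ce : (fun p : R * R => expR p.2) @ p --> expR p.2.
  by apply: continuous_comp; [exact: c2|exact: continuous_expR].
apply: cvgD; last by apply: cvgM.
by apply: cvgD; [apply: cvgM|exact: cvg_cst].
Qed.

(** Every potential is bounded below, so a bound on the sum of the potentials
    bounds each of them; one potential alone already has bounded sublevel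
    sets. Hence the sum has a minimum, and its two partial derivatives vanish
    there. *)
Lemma balanced_exists n (alpha : 'I_n -> H2 R) : (0 < n)%N ->
  exists P, balanced alpha P.
Proof.
move=> n0; pose i0 := Ordinal n0; pose a0 := Re (val (alpha i0)).
pose g (p : R * R) := \sum_(i < n) potential (alpha i) p.1 p.2.
(* A bound for the potential of [alpha i0] on the sublevel set of [(a0, 0)]. *)
pose K := g (a0, 0) - \sum_(i < n | i != i0) ln (2 * Im (val (alpha i))).
pose A := `[a0 - expR K, a0 + expR K] `*`
  `[2 * ln (Im (val (alpha i0))) - K, K] : set (R * R).
have sublevel p : g p <= g (a0, 0) -> A p.
  move=> gp; have : potential (alpha i0) p.1 p.2 <= K.
    rewrite /K lerBrDr; apply: le_trans gp.
    rewrite /g [X in _ <= X](bigD1 i0)//= lerD2l.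
    by apply: ler_sum => i _; exact: potential_ge.
  move=> /potential_sublevel[]; rewrite -/a0 ler_distl => xa uK uK'.
  by split; rewrite /= in_itv/= ?xa ?uK ?uK'.
have A0 : A (a0, 0) by exact: sublevel.
have cA : compact A by apply: compact_setX; exact: segment_compact.
have cg : {within A, continuous g}.
  apply: continuous_subspaceT; apply: continuous_big.
    by move=> [x y]; apply: continuousD; [exact: cvg_fst|exact: cvg_snd].
  by move=> i _; exact: continuous_potential.
have [[c d] _ gmin] := compact_EVT_min (ex_intro _ _ A0) cA cg.
have {}gmin p : g (c, d) <= g p.
  have [/sublevel Ap|/ltW] := leP (g p) (g (a0, 0)).
    by apply: gmin; exact/mem_set.
  by apply: le_trans; apply: gmin; exact/mem_set.
have critical (f df : R -> R) (t : R) :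
    (forall s : R, is_derive s (1 : R) f (df s)) ->
    (forall s, f t <= f s) -> df t = 0.
  move=> dfE fmin.
  have d0 : is_derive t (1 : R) f 0.
    apply: (@derive1_at_min _ f (t - 1) (t + 1)) => //; first lra.
    by rewrite in_itv/=; apply/andP; split; lra.
  rewrite -(@derive_val _ _ _ _ _ _ _ (dfE t)).
  by rewrite (@derive_val _ _ _ _ _ _ _ d0).
have crit_x :
    \sum_(i < n) (2 * (c - Re (val (alpha i))) / arg (alpha i) c d) = 0.
  apply: (critical (fun x : R => g (x, d)) (fun x : R =>
    \sum_(i < n) (2 * (x - Re (val (alpha i))) / arg (alpha i) x d))) => //.
  move=> s; rewrite /g/= -fct_sumE.
  by apply: is_derive_sum => i; exact: is_derive_potential_x.
have crit_u : \sum_(i < n) (2 * expR d ^+ 2 / arg (alpha i) c d - 1) = 0.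
  apply: (critical (fun u : R => g (c, u)) (fun u : R =>
    \sum_(i < n) (2 * expR u ^+ 2 / arg (alpha i) c u - 1))) => //.
  move=> s; rewrite /g/= -fct_sumE.
  by apply: is_derive_sum => i; exact: is_derive_potential_u.
have Pgt : 0 < Im (c +i* expR d)%C by exact: expR_gt0.
pose P : H2 R :=
  exist (fun z : R[i] => is_true (0 < Im z)) (c +i* expR d)%C Pgt.
have DE i : floor_sqdist P (val (alpha i)) = arg (alpha i) c d.
  by rewrite /floor_sqdist /arg /=; ring.
exists P; split.
  transitivity (- expR d *
      \sum_(i < n) (2 * (c - Re (val (alpha i))) / arg (alpha i) c d)).
    by rewrite mulr_sumr; apply: eq_bigr => i _; rewrite /dir1 DE /=; ring.
  by rewrite crit_x mulr0.
transitivity (- \sum_(i < n) (2 * expR d ^+ 2 / arg (alpha i) c d - 1)).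
  rewrite -sumrN; apply: eq_bigr => i _.
  by rewrite /dir3 DE /=; field; exact: lt0r_neq0 (arg_gt0 _ _ _).
by rewrite crit_u oppr0.
Qed.

End Existence.

(** * Julia's zero *)

Section JuliaZero.
Variables (R : realType) (n : nat) (F : bpoly R) (alpha : 'I_n -> H2 R).
Hypothesis alpha_roots : upper_roots F alpha.

Let upper : seq R[i] := [seq val (alpha i) | i <- index_enum 'I_n].
Let lower : seq R[i] := [seq conjc (val (alpha i)) | i <- index_enum 'I_n].

Lemma form_roots_upper_lower :
  perm_eq (form_roots (complexify F)) (upper ++ lower).
Proof.
apply: form_roots_perm_eq; have [a0 a0n0 ->] := alpha_roots.
exists a0%:C%C; first by rewrite eq_complex /= eqxx andbT.
by rewrite big_split big_cat !big_map.
Qed.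

Lemma julia_sum_form_roots w :
  julia_sum (form_roots (complexify F)) w = conj_pair_sum alpha w.
Proof.
rewrite /julia_sum (perm_big _ form_roots_upper_lower) big_cat !big_map.
by rewrite /conj_pair_sum big_split.
Qed.

Lemma upper_Im_gt0 beta : beta \in upper -> 0 < Im beta.
Proof. by case/mapP => i _ ->; exact: valP (alpha i). Qed.

Lemma lower_Im_lt0 beta : beta \in lower -> Im beta < 0.
Proof.
case/mapP => i _ ->; have := valP (alpha i).
by case: (val (alpha i)) => a b /=; rewrite oppr_lt0.
Qed.

(** A root and all its repetitions lie in one of the two half planes, each of
    which contains only [n] of the [2 * n] roots; multiplicity [n] thus means
    that it is the only root there. *)
Lemma stableNE : (0 < n)%N ->
  ~~ stable (2 * n) (complexify F) <-> (forall i j, alpha i = alpha j).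
Proof.
move=> n0.
have sz (T : Type) (f : 'I_n -> T) : size [seq f i | i <- index_enum 'I_n] = n.
  by rewrite size_map [index_enum _]unlock -enumT size_enum_ord.
have full (f : 'I_n -> R[i]) beta :
    (n <= count_mem beta [seq f i | i <- index_enum 'I_n])%N ->
    forall i, f i = beta.
  move=> nc i; have : all (pred1 beta) [seq f i | i <- index_enum 'I_n].
    by rewrite all_count eqn_leq count_size sz.
  by rewrite all_map => /allP/(_ i (mem_index_enum i))/eqP.
rewrite /stable (perm_all _ form_roots_upper_lower) -has_predC; split.
  case/hasP => beta _ /=; rewrite (permP form_roots_upper_lower) ltn_mul2l /=.
  rewrite -leqNgt count_cat => nc i j; apply: val_inj.
  have [beta0|beta0] := ltP 0 (Im beta).
    have /count_memPn c0 : beta \notin lower.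
      by apply/negP => /lower_Im_lt0; rewrite ltNge ltW.
    by rewrite c0 addn0 in nc; rewrite !(full _ _ nc).
  have /count_memPn c0 : beta \notin upper.
    by apply/negP => /upper_Im_gt0; rewrite ltNge beta0.
  rewrite c0 add0n in nc; apply: (can_inj (@conjcK R)).
  by rewrite !(full _ _ nc).
move=> eqa; pose i0 := Ordinal n0; apply/hasP; exists (val (alpha i0)).
  by rewrite mem_cat (map_f (fun i => val (alpha i)))// mem_index_enum.
rewrite /= (permP form_roots_upper_lower) ltn_mul2l /= -leqNgt count_cat.
apply: leq_trans (leq_addr _ _); rewrite -{1}(sz _ (fun i => val (alpha i))).
rewrite eq_leq//; apply/esym/eqP; rewrite -all_count all_map.
by apply/allP => i _ /=; rewrite (eqa i i0).
Qed.

Lemma julia_zero_stable_balanced P : balanced alpha P ->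
  (exists i, alpha i <> P) -> julia_zero_stable (complexify F) = H2_to_H3 P.
Proof.
move=> bal neq; have strict := balanced_strict_min bal neq.
apply: xget_unique => [w wP|w wmin]; first by rewrite !julia_sum_form_roots strict.
apply/eqP; apply: contraT => wP; have := wmin (H2_to_H3 P).
rewrite eq_sym wP !julia_sum_form_roots => /(_ isT).
by rewrite ltNge (ltW (strict _ wP)).
Qed.

Lemma julia_zero_unstable_const alpha0 : (0 < n)%N ->
  (forall i, alpha i = alpha0) ->
  julia_zero_unstable (complexify F) = H2_to_H3 alpha0.
Proof.
move=> n0 cst; pose i0 := Ordinal n0.
have memE (z : H2 R) : (val z \in form_roots (complexify F)) = (z == alpha0).
  rewrite (perm_mem form_roots_upper_lower) mem_cat orbC.
  have /negPf -> /= : val z \notin lower.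
    by apply/negP => /lower_Im_lt0; rewrite ltNge ltW// (valP z).
  apply/mapP/eqP => [[i _ /val_inj ->]//|->].
  by exists i0; rewrite ?mem_index_enum ?cst.
apply: xget_unique; first by exists alpha0.
by move=> w [a aE ->]; congr H2_to_H3; apply/eqP; rewrite -memE aE.
Qed.

End JuliaZero.

(** * The vector equation *)

Lemma sum_complex (R : rcfType) n (a b : 'I_n -> R) :
  \sum_(i < n) (a i +i* b i)%C = ((\sum_(i < n) a i) +i* (\sum_(i < n) b i))%C.
Proof. by elim/big_rec3: _ => // i x y z _ ->; simpc. Qed.

Lemma sum_tanh_balanced (R : realType) n (alpha : 'I_n -> H2 R) P
    (v : 'I_n -> R[i]) :
  (forall i, alpha i <> P -> unit_tangent_toward P (alpha i) (v i)) ->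
  \sum_(i < n) (tanh (dist_H2 P (alpha i)))%:C%C * v i = 0 <->
  balanced alpha P.
Proof.
move=> toward; under eq_bigr do rewrite (tanh_unit_tangent (toward _)).
rewrite sum_complex -!mulr_sumr; have y0 := lt0r_neq0 (valP P).
split=> [[/eqP e1 /eqP e3]|[-> ->]]; last by rewrite mulr0.
by split; apply/eqP; [move: e1|move: e3]; rewrite mulf_eq0 (negPf y0).
Qed.

Lemma balanced_const (R : realType) n (alpha : 'I_n -> H2 R) alpha0 P :
  (0 < n)%N -> (forall i, alpha i = alpha0) ->
  balanced alpha P <-> alpha0 = P.
Proof.
move=> n0 cst; rewrite -dir_eq0 /balanced.
under eq_bigr do rewrite cst; under [X in _ /\ X = _]eq_bigr do rewrite cst.
rewrite !sumr_const card_ord.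
split=> [[/eqP e1 /eqP e3]|[-> ->]]; last by rewrite mul0rn.
by move: e1 e3; rewrite !mulrn_eq0 (gtn_eqF n0) => /eqP -> /eqP ->.
Qed.

Theorem proposition9 (R : realType) (n : nat) (F : bpoly R)
    (alpha : 'I_n -> H2 R) (P : H2 R) (v : 'I_n -> R[i])
    (n_ge1 : (1 <= n)%N)
    (F_form : is_form (2 * n) F)
    (F_no_real_roots : no_real_roots F)
    (alpha_roots : upper_roots F alpha)
    (v_toward : forall i : 'I_n, alpha i <> P ->
       unit_tangent_toward P (alpha i) (v i)) :
  H2_to_H3 P = julia_zero (2 * n) F <->
  \sum_(i < n) (tanh (dist_H2 P (alpha i)))%:C * v i = 0.
Proof.
rewrite sum_tanh_balanced// /julia_zero; case: ifPn => st.
  have nonconst Q : exists i, alpha i <> Q.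
    apply: contrapT => /forallNP cst; move: st; apply/negP.
    apply/(stableNE alpha_roots n_ge1) => i j.
    by rewrite (contrapT (cst i)) (contrapT (cst j)).
  have [P0 bal0] := balanced_exists alpha n_ge1.
  have julia_zeroE := julia_zero_stable_balanced alpha_roots.
  rewrite (julia_zeroE _ bal0 (nonconst _)).
  split=> [/H2_to_H3_inj -> //|bal].
  by rewrite -(julia_zeroE _ bal (nonconst _)) (julia_zeroE _ bal0 (nonconst _)).
have cst i : alpha i = alpha (Ordinal n_ge1).
  exact: (stableNE alpha_roots n_ge1).1.
rewrite (julia_zero_unstable_const alpha_roots n_ge1 cst).
rewrite (balanced_const _ n_ge1 cst).
by split=> [/H2_to_H3_inj|->].
Qed.
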